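(* Let $x_0>2$ and $x_1\ge\max(x_0,14)$. Let $\{b_i'\}_{i=1}^M$ be a finite subdivision of $[\log(x_1),\infty)$, with $b_1'=\log(x_1)$ and $b_M'=\infty$. Define $$\varepsilon_{\pi,num}(x_1)=\max_{1\le i\le M-1}\varepsilon_{\pi,num}\left(\exp(b_i'),\exp(b_{i+1}')\right),$$ where $\varepsilon_{\pi,num}(y_1,y_2)=\varepsilon_{\theta,num}(y_1)\left(1+\mu_{num}(x_0,y_1,y_2)\right)$ is as defined in the context. Then $$E_\pi(x)\le \varepsilon_{\pi,num}(x_1)\quad\text{for all }x\ge x_1.$$
   Context: $\pi(x)$ is the number of primes $p\le x$; $\theta(x)=\sum_{p\le x}\log p$ (sum over primes); $\mathrm{Li}(x)=\int_2^x\frac{dt}{\log t}$. The error terms are $E_\pi(x)=\left|\frac{\pi(x)-\mathrm{Li}(x)}{x/\log x}\right|$ and $E_\theta(x)=\left|\frac{\theta(x)-x}{x}\right|$. A value $\varepsilon_{\theta,num}(y)$ is an admissible numerical bound for $E_\theta$ if $E_\theta(x)\le\varepsilon_{\theta,num}(y)$ for all $x\ge y$. Definition of $\mu_{num}(x_0,y_1,y_2)$, for $y_1\ge\max(x_0,14)$ and $y_1\le y_2\le\infty$: let $\{b_i\}_{i=1}^N$ be a finite partition of $[\log(x_0),\log(y_1)]$ with $b_1=\log(x_0)$, $b_N=\log(y_1)$ (one such partition is fixed for each $y_1$ that is used), and suppose admissible numerical bounds $\varepsilon_{\theta,num}(e^{b_i})$ are given for $i=1,\dots,N$. Put $$S=\frac{x_0\log(y_1)}{\varepsilon_{\theta,num}(y_1)y_1\log(x_0)}\left|\frac{\pi(x_0)-\mathrm{Li}(x_0)}{x_0/\log(x_0)}-\frac{\theta(x_0)-x_0}{x_0}\right|+\frac{\log(y_1)}{\varepsilon_{\theta,num}(y_1)y_1}\sum_{i=1}^{N-1}\varepsilon_{\theta,num}(e^{b_i})\left(\mathrm{Li}(e^{b_{i+1}})-\mathrm{Li}(e^{b_i})+\frac{e^{b_i}}{b_i}-\frac{e^{b_{i+1}}}{b_{i+1}}\right).$$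 If $y_1\le y_2\le y_1\log(y_1)$, then $$\mu_{num}(x_0,y_1,y_2)=S+\frac{\log(y_2)}{y_2}\left(\mathrm{Li}(y_2)-\frac{y_2}{\log(y_2)}-\mathrm{Li}(y_1)+\frac{y_1}{\log(y_1)}\right);$$ if $y_2>y_1\log(y_1)$, including $y_2=\infty$, then $$\mu_{num}(x_0,y_1,y_2)=S+\frac{1}{\log(y_1)+\log(\log(y_1))-1}.$$ *)

(* Defs.v *)
From Stdlib Require Import Reals List ZArith Znumtheory RList.
From Coquelicot Require Import Coquelicot.
Open Scope R_scope.

Definition primes_le (x : R) : list nat :=
  List.filter (fun p => if prime_dec (Z.of_nat p) then true else false)
    (List.seq 0 (S (Z.to_nat (Int_part x)))).

Definition prime_pi (x : R) : R := INR (length (primes_le x)).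

Definition theta (x : R) : R :=
  fold_right Rplus 0 (map (fun p => ln (INR p)) (primes_le x)).

Definition Li (x : R) : R := RInt (fun t => / ln t) 2 x.

Definition E_pi (x : R) : R := Rabs ((prime_pi x - Li x) / (x / ln x)).

Definition E_theta (x : R) : R := Rabs ((theta x - x) / x).

(* [e] is an admissible value of eps_{theta,num}(y). *)
Definition admissible_theta (e y : R) : Prop :=
  forall x, y <= x -> E_theta x <= e.

(* The points b 1 < ... < b n partition [lo, hi]. They are indexed from 1,
   and the values of b outside 1..n are irrelevant. Working in Rbar allows
   hi = +oo, in which case b i is finite for 1 <= i < n as soon as lo is.
   When lo = hi the only partition is the one-point one, n = 1. *)
Definition is_partition (n : nat) (b : nat -> Rbar) (lo hi : Rbar) : Prop :=
  (1 <= n)%nat /\ b 1%nat = lo /\ b n = hi /\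
  forall i, (1 <= i < n)%nat -> Rbar_lt (b i) (b (S i)).

Definition Rbar_exp (x : Rbar) : Rbar :=
  match x with
  | Finite r => Finite (exp r)
  | p_infty => p_infty
  | m_infty => Finite 0
  end.

(* In the definitions below, [eps y] is eps_{theta,num}(y), and the partition
   fixed for y1 is [b y1 1], ..., [b y1 (N y1)], a partition of
   [ln x0, ln y1]. *)

(* The part S of mu_num, which does not depend on y2. The sum is over
   1 <= i <= N y1 - 1 and is 0 when N y1 = 1. *)
Definition mu_base (eps : R -> R) (N : R -> nat) (b : R -> nat -> R)
    (x0 y1 : R) : R :=
  x0 * ln y1 / (eps y1 * y1 * ln x0)
    * Rabs ((prime_pi x0 - Li x0) / (x0 / ln x0) - (theta x0 - x0) / x0)
  + ln y1 / (eps y1 * y1)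
    * sum_n_m (fun i =>
        eps (exp (b y1 i))
        * (Li (exp (b y1 (S i))) - Li (exp (b y1 i))
           + exp (b y1 i) / b y1 i - exp (b y1 (S i)) / b y1 (S i)))
      1 (N y1 - 1).

(* Meant for y1 <= y2 <= +oo; the value at y2 = -oo is irrelevant. *)
Definition mu_num (eps : R -> R) (N : R -> nat) (b : R -> nat -> R)
    (x0 y1 : R) (y2 : Rbar) : R :=
  let far := mu_base eps N b x0 y1 + 1 / (ln y1 + ln (ln y1) - 1) in
  match y2 with
  | Finite y2 =>
      if Rle_dec y2 (y1 * ln y1) then
        mu_base eps N b x0 y1
        + ln y2 / y2 * (Li y2 - y2 / ln y2 - Li y1 + y1 / ln y1)
      else far
  | _ => far
  end.

Definition eps_pi_num2 (eps : R -> R) (N : R -> nat) (b : R -> nat -> R)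
    (x0 y1 : R) (y2 : Rbar) : R :=
  eps y1 * (1 + mu_num eps N b x0 y1 y2).

(* The maximum over 1 <= i <= M - 1, for a partition b' 1, ..., b' M of
   [ln x1, +oo]; b' i is finite for these i, and M >= 2. *)
Definition eps_pi_num (eps : R -> R) (N : R -> nat) (b : R -> nat -> R)
    (x0 : R) (M : nat) (b' : nat -> Rbar) : R :=
  MaxRlist (map (fun i =>
      eps_pi_num2 eps N b x0 (exp (real (b' i))) (Rbar_exp (b' (S i))))
    (List.seq 1 (M - 1))).

(* Main.v *)
Require Import Defs.
From Stdlib Require Import Reals List ZArith Znumtheory RList Lra Lia.
From Coquelicot Require Import Coquelicot.
Open Scope R_scope.

(** Partial summation compares the two error terms exactly. Put
    D(x) = pi(x) - Li(x) - (theta(x) - x) / log x  ([defect])  and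
    J(x) = Li(x) - x / log x  ([inv_ln_sq_int]), so that J' = 1 / log^2.
    At a prime p both pi and theta / log p jump by 1, so D is continuous; between
    consecutive integers pi and theta are constant and
    D'(t) = (theta(t) - t) / (t log^2 t), whence |D'| <= E_theta * J'. An
    admissible bound e at u therefore gives |D(v) - D(u)| <= e (J(v) - J(u)) for
    u <= v ([defect_increment]). No integral of theta is formed: the inequality
    is proved on each unit interval by comparing derivatives, and the unit
    intervals are then glued.

    Split D(x) as D(x0) + (D(y1) - D(x0)) + (D(x) - D(y1)). The first two terms
    are bounded by the two summands of S; multiplying by log x / x, which is at
    most log y1 / y1, gives eps(y1) * S. The third, together with E_theta(x),
    contributes eps(y1) (1 + g(x)), where g(x) = (log x / x) (J(x) - J(y1)).
    Multiplying S by eps(y1) undoes the divisions because eps(y1) > 0: theta is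
    constant between integers, so E_theta cannot vanish identically on a half-line.

    It remains to bound g on [y1, y2]. The key fact is [inv_ln_sq_int_le]:
    J(x) - J(y1) <= x / (L (L - 1)), L = log x, for all x up to y1 log y1. This
    says that g increases up to y1 log y1, which handles y2 <= y1 log y1; and
    evaluated at y1 log y1 itself it gives g <= 1 / (log (y1 log y1) - 1) on all
    of [y1, oo), which handles the remaining case. Finally, log x lies in one of
    the intervals of the subdivision, and the bound for that interval is at most
    the maximum. *)

(** * Auxiliary calculus *)

Lemma decr_of_derive_nonpos (f df : R -> R) (u v : R) :
  u <= v ->
  (forall t, u <= t <= v -> is_derive f t (df t)) ->
  (forall t, u < t < v -> df t <= 0) ->
  f v <= f u.
Proof.
  intros [huv | <-] Hd Hn; [| lra].
  destruct (MVT_cor2 f df u v huv) as [c [Ec Hc]].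
  - intros c Hc. apply is_derive_Reals. now apply Hd.
  - specialize (Hn c Hc). nra.
Qed.

Lemma ln_gt_0 (t : R) : 1 < t -> 0 < ln t.
Proof. intros Ht. rewrite <- ln_1. apply ln_increasing; lra. Qed.

Lemma gt_1_of_ln_gt_0 (t : R) : 0 < t -> 0 < ln t -> 1 < t.
Proof. intros Ht Hl. apply ln_lt_inv; [| | rewrite ln_1]; lra. Qed.

Lemma is_derive_Li (t : R) : 1 < t -> is_derive Li t (/ ln t).
Proof.
  intros Ht. unfold Li.
  assert (Hc : forall s, 1 < s -> continuous (fun t => / ln t) s).
  { intros s Hs. apply (ex_derive_continuous (fun t => / ln t)).
    assert (H := ln_gt_0 s Hs). auto_derive. repeat split; lra. }
  apply (is_derive_RInt (fun t => / ln t) _ 2); [| now apply Hc].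
  (* The ball of radius t - 1 around t stays in (1, oo), where 1 / log is continuous. *)
  exists (mkposreal (t - 1) ltac:(lra)). intros s Hs.
  apply Rabs_lt_between in Hs. cbn in Hs. unfold minus, plus, opp in Hs; cbn in Hs.
  apply (RInt_correct (V := R_CompleteNormedModule)).
  apply (ex_RInt_continuous (V := R_CompleteNormedModule)).
  intros z Hz. apply Hc.
  assert (1 < Rmin 2 s) by (apply Rmin_glb_lt; lra). lra.
Qed.

(** * The integral of 1 / log^2 *)

(** A primitive of 1 / log^2: integrating 1 / log by parts leaves the boundary
    term t / log t. *)
Definition inv_ln_sq_int (t : R) : R := Li t - t / ln t.

Lemma is_derive_inv_ln_sq_int (t : R) : 1 < t -> is_derive inv_ln_sq_int t (/ (ln t) ^ 2).
Proof.
  intros Ht. assert (HL := ln_gt_0 t Ht).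
  replace (/ ln t ^ 2) with (minus (/ ln t) (/ ln t - / (ln t) ^ 2)).
  2: { unfold minus, plus, opp; cbn. lra. }
  apply (is_derive_minus Li (fun t => t / ln t)).
  - now apply is_derive_Li.
  - auto_derive; [repeat split; lra |]. field. lra.
Qed.

Lemma decr_ln_over_id (u v : R) : 0 < u -> 1 <= ln u -> u <= v -> ln v / v <= ln u / u.
Proof.
  intros Hu Hl Huv.
  apply (decr_of_derive_nonpos (fun t => ln t / t) (fun t => (1 - ln t) / t ^ 2)); trivial.
  - intros t Ht. auto_derive; [repeat split; lra |]. field. lra.
  - intros t Ht. assert (ln u <= ln t) by (apply ln_le; lra).
    assert (0 < / t ^ 2) by (apply Rinv_0_lt_compat; nra). unfold Rdiv. nra.
Qed.

(** The function x / (L (L - 1)) - J(x), with L = log x, has derivative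
    -1 / (L (L - 1)^2) >= -1 / (l (l - 1)^2), l = log y. It thus drops from its
    value y / (l (l - 1)) at y, net of J(y), by at most
    (x - y) / (l (l - 1)^2), and this does not exceed y / (l (l - 1)) exactly
    when x <= y l. *)
Lemma inv_ln_sq_int_le (y x : R) :
  0 < y -> 1 < ln y -> y <= x <= y * ln y ->
  inv_ln_sq_int x - inv_ln_sq_int y <= x / (ln x * (ln x - 1)).
Proof.
  intros Hy Hl [Hyx Hx].
  assert (H1 := gt_1_of_ln_gt_0 y Hy ltac:(lra)).
  set (c := / (ln y * (ln y - 1) ^ 2)).
  assert (Hp : forall l, 1 < l -> 0 < l * (l - 1) ^ 2).
  { intros l Hl1. apply Rmult_lt_0_compat; [| apply pow_lt]; lra. }
  assert (Hc : 0 < c) by now apply Rinv_0_lt_compat, Hp.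
  set (g := fun t => inv_ln_sq_int t - t / (ln t * (ln t - 1)) - c * t).
  assert (Hd : g x <= g y).
  { apply (decr_of_derive_nonpos g
      (fun t => / (ln t * (ln t - 1) ^ 2) - c)); trivial.
    - intros t Ht. assert (ln y <= ln t) by (apply ln_le; lra).
      replace (/ (ln t * (ln t - 1) ^ 2) - c) with
        (minus (/ (ln t) ^ 2) (/ (ln t) ^ 2 - / (ln t * (ln t - 1) ^ 2) + c))
        by (unfold minus, plus, opp; cbn; ring).
      apply (is_derive_ext
        (fun t => minus (inv_ln_sq_int t) (t / (ln t * (ln t - 1)) + c * t))).
      { intros s. unfold g, minus, plus, opp; cbn. ring. }
      apply (is_derive_minus inv_ln_sq_int).
      + apply is_derive_inv_ln_sq_int. lra.
      + auto_derive; [repeat split; try lra; nra |]. field. lra.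
    - intros t Ht. assert (ln y <= ln t) by (apply ln_le; lra).
      assert (/ (ln t * (ln t - 1) ^ 2) <= c); [| lra].
      apply Rinv_le_contravar; [now apply Hp |].
      apply Rmult_le_compat; [lra | apply pow_le; lra | lra | apply pow_incr; lra]. }
  unfold g in Hd.
  assert (E : y / (ln y * (ln y - 1)) = c * (y * ln y - y)) by (unfold c; field; lra).
  nra.
Qed.

(** Since (log t / t)' = -(L - 1) / t^2 with L = log t, the derivative of
    (log t / t) (J(t) - J(y)) is nonnegative exactly when J(t) - J(y) <= t / (L (L - 1)). *)
Lemma incr_ln_over_id_int (y x z : R) :
  0 < y -> 1 < ln y -> y <= x <= z -> z <= y * ln y ->
  ln x / x * (inv_ln_sq_int x - inv_ln_sq_int y) <=
  ln z / z * (inv_ln_sq_int z - inv_ln_sq_int y).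
Proof.
  intros Hy Hl [Hyx Hxz] Hz.
  assert (H1 := gt_1_of_ln_gt_0 y Hy ltac:(lra)).
  enough (- (ln z / z * (inv_ln_sq_int z - inv_ln_sq_int y)) <=
          - (ln x / x * (inv_ln_sq_int x - inv_ln_sq_int y))) by lra.
  apply (decr_of_derive_nonpos (fun t => - (ln t / t * (inv_ln_sq_int t - inv_ln_sq_int y)))
    (fun t => - ((1 - ln t) / t ^ 2 * (inv_ln_sq_int t - inv_ln_sq_int y)
                + ln t / t * / (ln t) ^ 2))); trivial.
  - intros t Ht. assert (ln y <= ln t) by (apply ln_le; lra).
    apply (is_derive_opp (fun t => ln t / t * (inv_ln_sq_int t - inv_ln_sq_int y))).
    apply (is_derive_mult (fun t => ln t / t) (fun t => inv_ln_sq_int t - inv_ln_sq_int y) t).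
    + auto_derive; [repeat split; lra |]. field. lra.
    + replace (/ (ln t) ^ 2) with (minus (/ (ln t) ^ 2) 0)
        by (unfold minus, plus, opp; cbn; ring).
      apply (is_derive_minus inv_ln_sq_int (fun _ => inv_ln_sq_int y));
        [apply is_derive_inv_ln_sq_int; lra |].
      apply (is_derive_const (V := R_NormedModule)).
    + intros a b. apply Rmult_comm.
  - intros t Ht. assert (ln y <= ln t) by (apply ln_le; lra).
    assert (Hh := inv_ln_sq_int_le y t Hy Hl ltac:(lra)).
    assert (E : ln t / t * / ln t ^ 2 = (ln t - 1) / t ^ 2 * (t / (ln t * (ln t - 1))))
      by (field; lra).
    rewrite E.
    assert (0 <= (ln t - 1) / t ^ 2) by (apply Rdiv_le_0_compat; nra).
    replace ((1 - ln t) / t ^ 2) with (- ((ln t - 1) / t ^ 2)) by (field; lra).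
    nra.
Qed.

(** With z = y log y, the claim is that
    K(t) = J(t) - t / (log t (log z - 1)) never exceeds J(y). The numerator of
    K' is log z - log t, so K is largest at z, and there the claim is
    [inv_ln_sq_int_le]. *)
Lemma ln_over_id_int_le (y x : R) :
  0 < y -> 1 < ln y -> y <= x ->
  ln x / x * (inv_ln_sq_int x - inv_ln_sq_int y) <= 1 / (ln y + ln (ln y) - 1).
Proof.
  intros Hy Hl Hyx.
  assert (H1 := gt_1_of_ln_gt_0 y Hy ltac:(lra)).
  assert (Hll := ln_gt_0 _ Hl).
  set (z := y * ln y).
  assert (Hz : y <= z) by (unfold z; nra).
  assert (Ez : ln z = ln y + ln (ln y)) by (apply ln_mult; lra).
  rewrite <- Ez.
  set (K := fun t => inv_ln_sq_int t - t / (ln t * (ln z - 1))).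
  assert (HK : K z <= inv_ln_sq_int y).
  { assert (Hh := inv_ln_sq_int_le y z Hy Hl ltac:(unfold z in *; lra)). unfold K. lra. }
  assert (HD : forall t, y <= t -> is_derive K t ((ln z - ln t) / ((ln t) ^ 2 * (ln z - 1)))).
  { intros t Ht. assert (ln y <= ln t) by (apply ln_le; lra).
    replace ((ln z - ln t) / (ln t ^ 2 * (ln z - 1))) with
      (minus (/ (ln t) ^ 2) ((ln t - 1) / (ln t ^ 2 * (ln z - 1)))).
    2: { unfold minus, plus, opp; cbn. field. lra. }
    apply (is_derive_minus inv_ln_sq_int); [apply is_derive_inv_ln_sq_int; lra |].
    auto_derive; [repeat split; try lra; nra |]. field. lra. }
  assert (Hq : forall t, y <= t -> 0 < / (ln t ^ 2 * (ln z - 1))).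
  { intros t Ht. assert (ln y <= ln t) by (apply ln_le; lra).
    apply Rinv_0_lt_compat, Rmult_lt_0_compat; [apply pow_lt |]; lra. }
  assert (HKx : K x <= K z).
  { destruct (Rle_lt_dec z x) as [Hzx | Hxz].
    - apply (decr_of_derive_nonpos K _ z x Hzx (fun t Ht => HD t ltac:(lra))).
      intros t Ht. assert (ln z <= ln t) by (apply ln_le; lra).
      specialize (Hq t ltac:(lra)). unfold Rdiv. nra.
    - enough (- K z <= - K x) by lra.
      apply (decr_of_derive_nonpos (fun t => - K t) _ x z ltac:(lra)
        (fun t Ht => is_derive_opp K t _ (HD t ltac:(lra)))).
      intros t Ht. assert (ln t <= ln z) by (apply ln_le; lra).
      specialize (Hq t ltac:(lra)). unfold opp, Rdiv; cbn -[pow]. nra. }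
  unfold K at 1 in HKx. assert (ln y <= ln x) by (apply ln_le; lra).
  replace (1 / (ln z - 1)) with (ln x / x * (x / (ln x * (ln z - 1)))) by (field; lra).
  apply Rmult_le_compat_l; [apply Rdiv_le_0_compat; lra | lra].
Qed.

(** * Prime sums between consecutive integers *)

Lemma Int_part_between (n : nat) (t : R) : INR n <= t < INR (S n) -> Int_part t = Z.of_nat n.
Proof.
  intros Ht. symmetry. apply Int_part_spec. rewrite <- INR_IZR_INZ.
  rewrite S_INR in Ht. lra.
Qed.

Lemma primes_le_between (n : nat) (t : R) :
  INR n <= t < INR (S n) -> primes_le t = primes_le (INR n).
Proof.
  intros Ht. unfold primes_le. rewrite S_INR in Ht.
  rewrite !(Int_part_between n); trivial; rewrite S_INR; lra.
Qed.

Lemma primes_le_INR_S (n : nat) :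
  primes_le (INR (S n)) =
  primes_le (INR n) ++ (if prime_dec (Z.of_nat (S n)) then S n :: nil else nil).
Proof.
  unfold primes_le.
  rewrite (Int_part_between n (INR n)),
    (Int_part_between (S n) (INR (S n))) by (rewrite !S_INR; lra).
  rewrite !Nat2Z.id, (seq_S (S n)), filter_app. cbn [filter Nat.add].
  now destruct (prime_dec (Z.of_nat (S n))).
Qed.

(** If e <= 0 then theta(t) = t for all t >= y, but theta takes the same value
    at an integer m and at m + 1/2. *)
Lemma admissible_theta_pos (e y : R) : admissible_theta e y -> 0 < e.
Proof.
  intros He. destruct (nfloor_ex (Rmax y 2)) as [n Hn].
  { assert (H := Rmax_r y 2). lra. }
  assert (Hy := Rmax_l y 2). assert (H2 := Rmax_r y 2).
  set (m := INR (S n)). assert (Em : m = INR n + 1) by apply S_INR.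
  assert (B : forall t, m <= t < m + 1 -> - (e * t) <= theta m - t <= e * t).
  { intros t Ht. assert (Et := He t ltac:(lra)). unfold E_theta in Et.
    unfold theta in Et. rewrite (primes_le_between (S n) t) in Et
      by (rewrite (S_INR (S n)); exact Ht).
    fold m in Et. fold (theta m) in Et. apply Rabs_le_between in Et.
    replace (theta m - t) with ((theta m - t) / t * t) by (field; lra). nra. }
  assert (B1 := B m ltac:(lra)). assert (B2 := B (m + / 2) ltac:(lra)). nra.
Qed.

Lemma fold_right_Rplus_app (l1 l2 : list R) :
  fold_right Rplus 0 (l1 ++ l2) = fold_right Rplus 0 l1 + fold_right Rplus 0 l2.
Proof. induction l1 as [| r l1 IH]; cbn; [| rewrite IH]; ring. Qed.

(** * The exact difference between the two error terms *)

(** The part of pi - Li not accounted for by theta - x; by partial summation it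
    is, up to a constant, the integral of (theta(t) - t) / (t log^2 t). *)
Definition defect (t : R) : R := prime_pi t - Li t - (theta t - t) / ln t.

(** At the right endpoint n + 1 the values of pi and theta are those at n: if
    n + 1 is prime, the jump 1 of pi cancels against the jump log (n + 1) of
    theta divided by log (n + 1). This is the continuity of the defect. *)
Lemma defect_piece (n : nat) (t : R) :
  (2 <= n)%nat -> INR n <= t <= INR (S n) ->
  defect t = prime_pi (INR n) - Li t - (theta (INR n) - t) / ln t.
Proof.
  intros Hn [Hnt [Ht | ->]]; unfold defect, prime_pi, theta.
  - now rewrite (primes_le_between n t) by lra.
  - rewrite primes_le_INR_S.
    assert (Hl : 0 < ln (INR (S n))).
    { apply ln_gt_0. rewrite S_INR. apply le_INR in Hn. cbn in Hn. lra. }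
    rewrite map_app, fold_right_Rplus_app, length_app, plus_INR.
    destruct (prime_dec (Z.of_nat (S n))); cbn [map fold_right length];
      rewrite ?INR_1, ?INR_0; field; lra.
Qed.

(** On the open interval the derivative of the defect is
    (theta(t) - t) / (t log^2 t), of absolute value at most e / log^2 t; hence
    both e J - D and e J + D are nondecreasing. *)
Lemma defect_increment_piece (e : R) (n : nat) (u v : R) :
  (2 <= n)%nat -> INR n <= u -> u <= v -> v <= INR (S n) ->
  (forall t, u <= t -> E_theta t <= e) ->
  Rabs (defect v - defect u) <= e * (inv_ln_sq_int v - inv_ln_sq_int u).
Proof.
  intros Hn Hu Huv Hv He.
  assert (Hn2 := le_INR _ _ Hn). cbn in Hn2.
  rewrite !(defect_piece n) by (trivial; lra).
  set (p := prime_pi (INR n)). set (th := theta (INR n)).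
  set (G := fun t => p - Li t - (th - t) / ln t).
  assert (HG : forall t, u <= t -> is_derive G t ((th - t) / (t * ln t ^ 2))).
  { intros t Ht. assert (HL := ln_gt_0 t ltac:(lra)).
    replace ((th - t) / (t * ln t ^ 2)) with
      (minus (opp (/ ln t)) (- / ln t - (th - t) / (t * ln t ^ 2))).
    2: { unfold minus, plus, opp; cbn. ring. }
    apply (is_derive_minus (fun t => p - Li t) (fun t => (th - t) / ln t)).
    - replace (opp (/ ln t)) with (minus 0 (/ ln t)) by (unfold minus, plus, opp; cbn; ring).
      apply (is_derive_minus (fun _ => p) Li).
      + apply (is_derive_const (V := R_NormedModule)).
      + apply is_derive_Li; lra.
    - auto_derive; [repeat split; lra |]. field. lra. }
  assert (HB : forall t, u < t < v ->
    - (e * / ln t ^ 2) <= (th - t) / (t * ln t ^ 2) <= e * / ln t ^ 2).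
  { intros t Ht. assert (HL := ln_gt_0 t ltac:(lra)).
    assert (Et := He t ltac:(lra)). unfold E_theta, theta in Et.
    rewrite (primes_le_between n t) in Et by lra. fold (theta (INR n)) in Et. fold th in Et.
    apply Rabs_le_between in Et.
    replace ((th - t) / (t * ln t ^ 2)) with ((th - t) / t * / ln t ^ 2) by (field; lra).
    assert (0 < / ln t ^ 2) by (apply Rinv_0_lt_compat; nra). nra. }
  fold (G v) (G u).
  assert (HJ : forall t, u <= t ->
    is_derive (fun t => e * inv_ln_sq_int t) t (e * / ln t ^ 2)).
  { intros t Ht. apply (is_derive_scal inv_ln_sq_int). apply is_derive_inv_ln_sq_int. lra. }
  apply Rabs_le_between. split.
  - enough (- G v - e * inv_ln_sq_int v <= - G u - e * inv_ln_sq_int u) by lra.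
    apply (decr_of_derive_nonpos (fun t => - G t - e * inv_ln_sq_int t) _ u v Huv
      (fun t Ht => is_derive_minus (fun t => - G t) _ t _ _
         (is_derive_opp G t _ (HG t (proj1 Ht))) (HJ t (proj1 Ht)))).
    intros t Ht. specialize (HB t Ht).
    change (- ((th - t) / (t * ln t ^ 2)) - e * / ln t ^ 2 <= 0). lra.
  - enough (G v - e * inv_ln_sq_int v <= G u - e * inv_ln_sq_int u) by lra.
    apply (decr_of_derive_nonpos (fun t => G t - e * inv_ln_sq_int t) _ u v Huv
      (fun t Ht => is_derive_minus G _ t _ _ (HG t (proj1 Ht)) (HJ t (proj1 Ht)))).
    intros t Ht. specialize (HB t Ht).
    change ((th - t) / (t * ln t ^ 2) - e * / ln t ^ 2 <= 0). lra.
Qed.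

Lemma increment_bound_trans (f g : R -> R) (e a b c : R) :
  Rabs (f b - f a) <= e * (g b - g a) ->
  Rabs (f c - f b) <= e * (g c - g b) ->
  Rabs (f c - f a) <= e * (g c - g a).
Proof.
  intros H1%Rabs_le_between H2%Rabs_le_between. apply Rabs_le_between. lra.
Qed.

(** The unit intervals are glued by induction on an integer bound k of v. *)
Lemma defect_increment (e u v : R) :
  2 < u <= v -> (forall t, u <= t -> E_theta t <= e) ->
  Rabs (defect v - defect u) <= e * (inv_ln_sq_int v - inv_ln_sq_int u).
Proof.
  intros [Hu Huv] He.
  assert (Hk : exists k : nat, v <= INR k).
  { destruct (nfloor_ex v ltac:(lra)) as [k Hk]. exists (S k). rewrite S_INR. lra. }
  destruct Hk as [k Hk]. revert v Huv Hk.
  induction k as [| k IH]; intros v Huv Hk; [cbn in Hk; lra |].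
  destruct (Rle_lt_dec v (INR k)) as [H | H]; [now apply IH |].
  assert (Hk2 : (2 < S k)%nat) by (apply INR_lt; cbn [INR] in *; lra).
  destruct (Rle_lt_dec (INR k) u) as [Hku | Huk].
  - apply (defect_increment_piece e k); trivial; lia || lra.
  - apply (increment_bound_trans defect inv_ln_sq_int e u (INR k) v).
    + apply IH; lra.
    + apply (defect_increment_piece e k); lia || lra || idtac. intros t Ht. apply He. lra.
Qed.

(** The summand is the bound of [defect_increment] on one interval of the
    partition, with log (exp (b i)) simplified to b i. *)
Lemma defect_increment_partition (eps : R -> R) (b : nat -> R) (n : nat) :
  (1 <= n)%nat -> 2 < exp (b 1%nat) ->
  (forall i, (1 <= i < n)%nat -> b i < b (S i)) ->
  (forall i, (1 <= i <= n)%nat -> admissible_theta (eps (exp (b i))) (exp (b i))) ->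
  Rabs (defect (exp (b n)) - defect (exp (b 1%nat))) <=
  sum_n_m (fun i =>
    eps (exp (b i))
    * (Li (exp (b (S i))) - Li (exp (b i))
       + exp (b i) / b i - exp (b (S i)) / b (S i))) 1 (n - 1).
Proof.
  intros Hn H2 Hb He. destruct n as [| n]; [lia |].
  replace (S n - 1)%nat with n by lia. clear Hn.
  assert (Hmono : forall i, (i <= n)%nat -> b 1%nat <= b (S i)).
  { induction i as [| i IH]; intros Hi; [lra |].
    specialize (IH ltac:(lia)). specialize (Hb (S i) ltac:(lia)). lra. }
  induction n as [| n IH].
  - rewrite sum_n_m_zero by lia. rewrite Rminus_eq_0, Rabs_R0. apply Rle_refl.
  - rewrite sum_n_Sm by lia.
    assert (Hs : b (S n) < b (S (S n))) by (apply Hb; lia).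
    assert (Hu : exp (b 1%nat) <= exp (b (S n))).
    { destruct (Hmono n ltac:(lia)) as [H | H];
        [left; now apply exp_increasing | rewrite H; lra]. }
    assert (Hstep : Rabs (defect (exp (b (S (S n)))) - defect (exp (b (S n)))) <=
      eps (exp (b (S n)))
      * (inv_ln_sq_int (exp (b (S (S n)))) - inv_ln_sq_int (exp (b (S n))))).
    { apply defect_increment; [| apply He; lia].
      split; [lra | left; now apply exp_increasing]. }
    unfold inv_ln_sq_int in Hstep. rewrite !ln_exp in Hstep.
    assert (IHn : Rabs (defect (exp (b (S n))) - defect (exp (b 1%nat))) <=
      sum_n_m (fun i =>
        eps (exp (b i))
        * (Li (exp (b (S i))) - Li (exp (b i))
           + exp (b i) / b i - exp (b (S i)) / b (S i))) 1 n).
    { apply IH; intros; [apply Hb | apply He | apply Hmono]; lia. }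
    replace (defect (exp (b (S (S n)))) - defect (exp (b 1%nat))) with
      ((defect (exp (b (S n))) - defect (exp (b 1%nat)))
       + (defect (exp (b (S (S n)))) - defect (exp (b (S n))))) by ring.
    eapply Rle_trans; [apply Rabs_triang |].
    apply Rplus_le_compat; [exact IHn |].
    eapply Rle_trans; [exact Hstep |]. apply Req_le. ring.
Qed.

(** * Comparison with the numerical bound *)

(** The split of D(x) at x0 and y, with (log x / x) (J(x) - J(y)) kept exact. The
    bound on it is substituted inside the factor eps y, which is why the
    positivity of eps y is part of the conclusion. *)
Lemma E_pi_le_mu_base (eps : R -> R) (N : R -> nat) (b : R -> nat -> R) (x0 y x : R) :
  2 < x0 -> x0 <= y <= x -> 1 < ln y ->
  is_partition (N y) (fun j => Finite (b y j)) (Finite (ln x0)) (Finite (ln y)) ->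
  (forall j, (1 <= j <= N y)%nat ->
    admissible_theta (eps (exp (b y j))) (exp (b y j))) ->
  0 < eps y /\
  E_pi x <=
  eps y * (1 + (mu_base eps N b x0 y + ln x / x * (inv_ln_sq_int x - inv_ln_sq_int y))).
Proof.
  intros Hx0 [H0y Hyx] Hl [HN [Hb1 [HbN Hb]]] He.
  cbn in Hb. injection Hb1 as Hb1. injection HbN as HbN.
  assert (Hey : admissible_theta (eps y) y).
  { specialize (He (N y) ltac:(lia)). rewrite HbN, exp_ln in He by lra. exact He. }
  assert (Hpos := admissible_theta_pos _ _ Hey). split; [exact Hpos |].
  assert (Hsum := defect_increment_partition eps (b y) (N y) HN).
  rewrite Hb1, HbN, !exp_ln in Hsum by lra. specialize (Hsum Hx0 Hb He).
  assert (Hinc := defect_increment (eps y) y x ltac:(lra) Hey).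
  assert (Hlx : ln y <= ln x) by (apply ln_le; lra).
  assert (Hl0 := ln_gt_0 x0 ltac:(lra)).
  unfold mu_base. set (Sg := sum_n_m _ _ _) in *.
  set (A := Rabs (defect x0)).
  (* The boundary term of S at x0 is the absolute value of the defect there. *)
  assert (EA : x0 / ln x0 *
    Rabs ((prime_pi x0 - Li x0) / (x0 / ln x0) - (theta x0 - x0) / x0) = A).
  { unfold A. rewrite <- (Rabs_pos_eq (x0 / ln x0)) at 1 by (apply Rdiv_le_0_compat; lra).
    rewrite <- Rabs_mult. f_equal. unfold defect. field. lra. }
  replace (eps y * _) with
    (ln y / y * (A + Sg) + (eps y + ln x / x * (eps y * (inv_ln_sq_int x - inv_ln_sq_int y)))).
  2: { rewrite <- EA. field. lra. }
  assert (EE : (prime_pi x - Li x) / (x / ln x) = ln x / x * defect x + (theta x - x) / x).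
  { unfold defect. field. lra. }
  unfold E_pi. rewrite EE.
  assert (Hth : Rabs ((theta x - x) / x) <= eps y) by (apply Hey; lra).
  assert (HF : Rabs (defect x) <= A + Sg + eps y * (inv_ln_sq_int x - inv_ln_sq_int y)).
  { replace (defect x) with (defect x0 + (defect y - defect x0) + (defect x - defect y))
      by ring.
    eapply Rle_trans; [apply Rabs_triang |]. apply Rplus_le_compat; [| exact Hinc].
    eapply Rle_trans; [apply Rabs_triang |]. apply Rplus_le_compat_l. exact Hsum. }
  assert (Hdec := decr_ln_over_id y x ltac:(lra) ltac:(lra) Hyx).
  assert (Hq : 0 <= ln x / x) by (apply Rdiv_le_0_compat; lra).
  assert (HASg : 0 <= A + Sg).
  { assert (HA := Rabs_pos (defect x0)).
    assert (HS := Rabs_pos (defect y - defect x0)). unfold A. lra. }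
  eapply Rle_trans; [apply Rabs_triang |].
  rewrite Rabs_mult, (Rabs_pos_eq (ln x / x)) by exact Hq.
  assert (P1 := Rmult_le_compat_l _ _ _ Hq HF).
  assert (P2 := Rmult_le_compat_r _ _ _ HASg Hdec). lra.
Qed.

Lemma ln_over_id_int_le_mu_num (eps : R -> R) (N : R -> nat) (b : R -> nat -> R)
    (x0 y x : R) (y2 : Rbar) :
  0 < y -> 1 < ln y -> y <= x -> Rbar_le x y2 ->
  mu_base eps N b x0 y + ln x / x * (inv_ln_sq_int x - inv_ln_sq_int y) <=
  mu_num eps N b x0 y y2.
Proof.
  intros Hy Hl Hyx Hx2. assert (Hfar := ln_over_id_int_le y x Hy Hl Hyx).
  unfold mu_num. destruct y2 as [z | |]; [| lra | contradiction].
  destruct (Rle_dec z (y * ln y)) as [Hz |]; [| lra].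
  assert (Hm := incr_ln_over_id_int y x z Hy Hl (conj Hyx Hx2) Hz).
  unfold inv_ln_sq_int in *. lra.
Qed.

Lemma partition_locate (n : nat) (b : nat -> Rbar) (lo t : R) :
  is_partition n b (Finite lo) p_infty -> lo <= t ->
  exists i, (1 <= i < n)%nat /\
    exists r, b i = Finite r /\ lo <= r <= t /\ Rbar_lt t (b (S i)).
Proof.
  intros [Hn [H1 [Hlast Hlt]]] Ht.
  destruct n as [| n]; [lia |]. clear Hn.
  assert (Hhit : Rbar_lt t (b (S n))) by now rewrite Hlast.
  clear Hlast. induction n as [| n IH].
  - rewrite H1 in Hhit. cbn in Hhit. lra.
  - assert (Hlow : forall i, (1 <= i <= S n)%nat -> Rbar_le lo (b i)).
    { induction i as [| i IHi]; intros Hi; [lia |].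
      destruct i as [| i]; [rewrite H1; apply Rbar_le_refl |].
      eapply Rbar_le_trans; [apply IHi; lia |]. apply Rbar_lt_le, Hlt. lia. }
    destruct (Rbar_lt_dec t (b (S n))) as [H | H].
    + destruct (IH ltac:(intros; apply Hlt; lia) H) as [i [Hi Hr]].
      exists i. split; [lia | exact Hr].
    + apply Rbar_not_lt_le in H. specialize (Hlow (S n) ltac:(lia)).
      exists (S n). split; [lia |].
      destruct (b (S n)) as [r | |]; [| contradiction | contradiction].
      exists r. cbn in H, Hlow. repeat split; trivial.
Qed.

Theorem corollary8
  (eps : R -> R) (N : R -> nat) (b : R -> nat -> R)
  (x0 x1 : R) (M : nat) (b' : nat -> Rbar)
  (hx0 : 2 < x0)
  (hx1 : Rmax x0 14 <= x1)
  (hb' : is_partition M b' (Finite (ln x1)) p_infty)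
  (hb : forall i, (1 <= i < M)%nat ->
     let y1 := exp (real (b' i)) in
     is_partition (N y1) (fun j => Finite (b y1 j))
       (Finite (ln x0)) (Finite (ln y1)))
  (heps : forall i, (1 <= i < M)%nat ->
     let y1 := exp (real (b' i)) in
     forall j, (1 <= j <= N y1)%nat ->
       admissible_theta (eps (exp (b y1 j))) (exp (b y1 j))) :
  forall x, x1 <= x -> E_pi x <= eps_pi_num eps N b x0 M b'.
Proof.
  intros x Hx.
  assert (Hx10 := Rle_trans _ _ _ (Rmax_l _ _) hx1).
  assert (Hx114 := Rle_trans _ _ _ (Rmax_r _ _) hx1).
  destruct (partition_locate M b' (ln x1) (ln x) hb') as [i [Hi [r [Hr [[Hlo Hrx] Hnext]]]]].
  { apply ln_le; lra. }
  specialize (hb i Hi). specialize (heps i Hi). cbn zeta in hb, heps.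
  apply Rle_trans with
    (eps_pi_num2 eps N b x0 (exp (real (b' i))) (Rbar_exp (b' (S i)))).
  2: { apply MaxRlist_P1.
       apply (in_map (fun i =>
         eps_pi_num2 eps N b x0 (exp (real (b' i))) (Rbar_exp (b' (S i))))).
       apply in_seq. lia. }
  rewrite Hr in hb, heps |- *. cbn [real] in *.
  set (y := exp r) in *.
  assert (Hy1 : x1 <= y).
  { rewrite <- (exp_ln x1) by lra. destruct Hlo as [H | <-];
      [left; now apply exp_increasing | apply Rle_refl]. }
  assert (Hyx : y <= x).
  { rewrite <- (exp_ln x) by lra. destruct Hrx as [H | ->];
      [left; now apply exp_increasing | apply Rle_refl]. }
  assert (Hl : 1 < ln y).
  { rewrite <- (ln_exp 1). apply ln_increasing; [apply exp_pos |].
    assert (H3 := exp_le_3). lra. }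
  destruct (E_pi_le_mu_base eps N b x0 y x hx0 ltac:(lra) Hl hb heps) as [Hpos HE].
  assert (Hx2 : Rbar_le x (Rbar_exp (b' (S i)))).
  { destruct (b' (S i)) as [s | |]; cbn in *; trivial; [| contradiction].
    rewrite <- (exp_ln x) by lra. left. now apply exp_increasing. }
  assert (Hmu := ln_over_id_int_le_mu_num eps N b x0 y x _ ltac:(lra) Hl Hyx Hx2).
  eapply Rle_trans; [exact HE |]. unfold eps_pi_num2.
  apply Rmult_le_compat_l; lra.
Qed.
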